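(* Let $X^1,\dots,X^n$ be sample databases, let $f$ be a real-valued statistical query, and let $\epsilon>0$. Let $\hat p$ and, for each individual $i$, $\hat p_i$ be probability density estimators on $\mathbb{R}$ inferred from the sets of samples $\{f(X^1),\dots,f(X^n)\}$ and $\{f(X_i^1),\dots,f(X_i^n)\}$, respectively, where $X_i^j$ is $X^j$ with the data of individual $i$ removed. Suppose that for each $i$ the densities $\hat p$ and $\hat p_i$ differ by a factor of at most $e^{\epsilon}$ (that is, $\hat p\le e^{\epsilon}\hat p_i$ and $\hat p_i\le e^{\epsilon}\hat p$) except on a measurable set $\overline{A}_i\subseteq\mathbb{R}$, and set $$\delta_i=\max\left(\int_{\overline{A}_i}\bigl(\hat p(x)-e^{\epsilon}\hat p_i(x)\bigr)_+\,dx,\ \int_{\overline{A}_i}\bigl(\hat p_i(x)-e^{\epsilon}\hat p(x)\bigr)_+\,dx\right),\qquad \delta=\max_i\delta_i .$$ Then $f$ is empirically $(\epsilon,\delta)$-differentially private with respect to these estimators: for every individual $i$ and every measurable $E\subseteq\mathbb{R}$, $$\int_E\hat p_i\,dx\le e^{\epsilon}\int_E\hat p\,dx+\delta\qquad\text{and}\qquad\int_E\hat p\,dx\le e^{\epsilon}\int_E\hat p_i\,dx+\delta .$$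
   Context: A database is a finite set of records, each carrying the identity of an individual; individuals have a unique identity across databases. The sample databases $X^1,\dots,X^n$ are drawn independently from an unknown distribution $\chi$. Write $t_+=\max(t,0)$. The estimated probability measures of the query result with all individuals included and with individual $i$ removed are $\widehat P(E)=\int_E\hat p\,dx$ and $\widehat P_i(E)=\int_E\hat p_i\,dx$. The query $f$ is empirically $(\epsilon,\delta)$-differentially private (with respect to these estimators) if for all individuals $i$ and all measurable sets $E$ of query results, $\widehat P_i(E)\le e^{\epsilon}\widehat P(E)+\delta$ and $\widehat P(E)\le e^{\epsilon}\widehat P_i(E)+\delta$. *)

(* Defs.v *)
From mathcomp Require Export all_boot all_order all_algebra.
From mathcomp Require Export finmap.
From mathcomp Require Export all_classical all_reals all_analysis.

Set Implicit Arguments.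
Unset Strict Implicit.
Unset Printing Implicit Defensive.

Import Order.TTheory GRing.Theory Num.Theory.
Import numFieldNormedType.Exports.

Local Open Scope classical_set_scope.
Local Open Scope fset_scope.
Local Open Scope ring_scope.

Notation database Rec := {fset Rec}.

(* [ident] does not depend on the database: an individual keeps the same
   identity across databases. *)
Definition remove (Rec : choiceType) (Ind : eqType) (ident : Rec -> Ind)
    (i : Ind) (x : database Rec) : database Rec :=
  [fset r in x | ident r != i].

Definition mutually_independent d d' (Omega : measurableType d)
    (T : measurableType d') (R : realType) (P : probability Omega R)
    (n : nat) (X : 'I_n -> {RV P >-> T}) :=
  forall (J : {set 'I_n}) (B : 'I_n -> set T),
    (forall j, measurable (B j)) ->
    P (\bigcap_(j in [set` J]) (X j @^-1` B j)) =
    (\prod_(j in J) P (X j @^-1` B j))%E.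

Definition iid_sample d d' (Omega : measurableType d)
    (T : measurableType d') (R : realType) (P : probability Omega R)
    (chi : probability T R) (n : nat) (X : 'I_n -> {RV P >-> T}) :=
  mutually_independent X /\
  forall j B, measurable B -> distribution P (X j) B = chi B.

Definition query_samples (Rec : choiceType) (R : realType)
    (f : database Rec -> R) (n : nat) (x : 'I_n -> database Rec) :
    n.-tuple R :=
  [tuple f (x j) | j < n].

(* Maps the observed values of the query to a function on the real line. *)
Definition estimator (R : realType) (n : nat) := n.-tuple R -> R -> R.

Definition phat (Rec : choiceType) (R : realType) (f : database Rec -> R)
    (n : nat) (est : estimator R n) (x : 'I_n -> database Rec) : R -> R :=
  est (query_samples f x).

(* The estimators [est_ i] are not required to be the same as the estimator
   used for the unmodified samples. *)
Definition phat_removed (Rec : choiceType) (Ind : eqType)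
    (ident : Rec -> Ind) (R : realType) (f : database Rec -> R) (n : nat)
    (est_ : Ind -> estimator R n) (x : 'I_n -> database Rec) (i : Ind) :
    R -> R :=
  est_ i (query_samples f (fun j => remove ident i (x j))).

Definition prob_density (R : realType) (p : R -> R) :=
  [/\ measurable_fun [set: R] p,
      forall x, 0 <= p x &
      (\int[lebesgue_measure]_x (p x)%:E = 1)%E].

Definition density_measure (R : realType) (p : R -> R) (E : set R) : \bar R :=
  (\int[lebesgue_measure]_(x in E) (p x)%:E)%E.

Definition empirically_dp (Rec : choiceType) (Ind : eqType)
    (ident : Rec -> Ind) (R : realType) (f : database Rec -> R) (n : nat)
    (est : estimator R n) (est_ : Ind -> estimator R n)
    (x : 'I_n -> database Rec) (eps delta : R) :=
  let Phat := density_measure (phat f est x) in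
  let Phat_ i := density_measure (phat_removed ident f est_ x i) in
  forall (i : Ind) (E : set R), measurable E ->
    (Phat_ i E <= (expR eps)%:E * Phat E + delta%:E)%E /\
    (Phat E <= (expR eps)%:E * Phat_ i E + delta%:E)%E.

Definition density_excess (R : realType) (eps : R) (A : set R)
    (p q : R -> R) : \bar R :=
  (\int[lebesgue_measure]_(x in A) (Num.max (p x - expR eps * q x) 0)%:E)%E.

Definition delta_of (R : realType) (eps : R) (A : set R) (p q : R -> R) :
    \bar R :=
  maxe (density_excess eps A p q) (density_excess eps A q p).

Definition is_max d (T : porderType d) (S : set T) (m : T) :=
  S m /\ ubound S m.

(* Main.v *)
Require Import Defs.
From mathcomp Require Import measurable_realfun.

Set Implicit Arguments.
Unset Strict Implicit.
Unset Printing Implicit Defensive.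

Import Order.TTheory GRing.Theory Num.Theory.
Import numFieldNormedType.Exports.

Local Open Scope classical_set_scope.
Local Open Scope ring_scope.

(** For a fixed individual the claim concerns two densities on the line. Integrating the pointwise
    bound over [E] gives the factor [expR eps] times the other measure, plus the positive part
    integrated over [E]. That part is nonnegative and lives on the exceptional set, so its share in
    [E] is at most its full integral there, whatever [E] is. [density_measure_le_excess] is this
    one-sided bound; using it in both directions yields both inequalities, since [delta] dominates
    both excesses. *)

(* Everywhere [p <= e^eps q + (p - e^eps q)_+], and the last term vanishes off
   the exceptional set. *)
Lemma density_measure_le_excess (R : realType) (eps : R) (p q : R -> R)
    (A E : set R) :
  prob_density p -> prob_density q -> measurable E ->
  (forall x, ~ A x -> p x <= expR eps * q x) ->
  (density_measure p E <=
     (expR eps)%:E * density_measure q E + density_excess eps A p q)%E.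
Proof.
move=> [mp p0 _] [mq q0 _] mE off_A.
pose h x : R := Num.max (p x - expR eps * q x) 0.
have cq0 x : 0 <= expR eps * q x by rewrite mulr_ge0// expR_ge0.
have h0 x : 0 <= h x by rewrite /h le_max lexx orbT.
have mcq : measurable_fun [set: R] (fun x => expR eps * q x).
  exact: measurable_funM.
have mh : measurable_fun [set: R] h.
  by apply: measurable_maxr => //; exact: measurable_funB.
have mER (g : R -> R) : measurable_fun [set: R] g ->
    measurable_fun E (fun x => (g x)%:E).
  move=> mg; apply/measurable_EFinP.
  exact: measurable_funS mg.
(* Since [h] vanishes off [A], the excess is an integral over the whole line, which can be compared
   with the one over [E] by mere inclusion of domains. *)
have excess_off_A : (\int[lebesgue_measure]_x (h x)%:E =
    density_excess eps A p q)%E.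
  rewrite /density_excess [RHS]integral_mkcond; apply: eq_integral => x _.
  rewrite patchE; case: ifPn => // /negP; rewrite inE => /off_A px.
  by congr EFin; apply: max_r; rewrite subr_le0.
rewrite -excess_off_A /density_measure.
rewrite -ge0_integralZl_EFin ?expR_ge0//; first last.
- exact: mER.
- by move=> x _; rewrite lee_fin.
apply: (@le_trans _ _ (\int[lebesgue_measure]_(x in E)
    ((expR eps)%:E * (q x)%:E + (h x)%:E))%E).
  apply: ge0_le_integral => //.
  - by move=> x _; rewrite lee_fin.
  - exact: mER.
  - by under eq_fun do rewrite -EFinM -EFinD; apply: mER; exact: measurable_funD.
  - by move=> x _; rewrite -EFinM -EFinD lee_fin addrC -lerBlDr le_max lexx.
rewrite ge0_integralD//; first last.
- exact: mER.
- by move=> x _; rewrite lee_fin.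
- by under eq_fun do rewrite -EFinM; exact: mER.
- by move=> x _; rewrite -EFinM lee_fin.
(* Enlarging [E] to the whole line only increases the integral of [h], as [h] is nonnegative. *)
apply: leeD2l; apply: ge0_subset_integral => //.
- exact/measurable_EFinP.
- by move=> x _; rewrite lee_fin.
Qed.

Theorem theorem1 (R : realType) (Ind : eqType) (Rec : choiceType)
  (ident : Rec -> Ind)
  (G : set (set (database Rec)))
  (chi : probability (g_sigma_algebraType G) R)
  (d : measure_display) (Omega : measurableType d) (P : probability Omega R)
  (n : nat) (X : 'I_n -> {RV P >-> g_sigma_algebraType G})
  (X_iid : iid_sample chi X)
  (w : Omega)
  (f : database Rec -> R) (eps : R) (eps_gt0 : 0 < eps)
  (est : estimator R n) (est_ : Ind -> estimator R n)
  (p : R -> R) (p_def : p = phat f est (fun j => X j w))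
  (p_ : Ind -> R -> R)
  (p_i_def : forall i, p_ i = phat_removed ident f est_ (fun j => X j w) i)
  (p_density : prob_density p)
  (p_i_density : forall i, prob_density (p_ i))
  (A : Ind -> set R) (A_meas : forall i, measurable (A i))
  (ratio : forall i x, ~ A i x ->
     p x <= expR eps * p_ i x /\ p_ i x <= expR eps * p x)
  (delta : R)
  (delta_max : is_max [set delta_of eps (A i) p (p_ i) | i in [set: Ind]]
                 delta%:E) :
  empirically_dp ident f est est_ (fun j => X j w) eps delta.
Proof.
case: delta_max => _ delta_ub.
rewrite /empirically_dp -p_def /= => i E mE; rewrite -p_i_def.
have : (delta_of eps (A i) p (p_ i) <= delta%:E)%E.
  by apply: delta_ub; exists i.
rewrite /delta_of ge_max => /andP[excess_p excess_pi]; split.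
(* Here [p_ i] is the density being bounded, so the excess of [p_ i] over [p] is the relevant one;
   the other case swaps the roles. *)
- apply: le_trans (leeD2l _ excess_pi).
  by apply: density_measure_le_excess => // x /ratio[].
- apply: le_trans (leeD2l _ excess_p).
  by apply: density_measure_le_excess => // x /ratio[].
Qed.
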